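(* Let $\sigma\in\mathcal{W}_{2,ac}(\mathbb{R}^n)$ and $\mu\in\mathcal{W}_2(\mathbb{R}^n)$. Then for any $P\in O(n)$ and any map $S:\mathbb{R}^n\to\mathbb{R}^n$ of the form $S(x)=ax+b$ with $a>0$, $b\in\mathbb{R}^n$, $$\mathcal{U}(S_\sharp\sigma,\mu,P)=\mathcal{U}(\sigma,\mu,P),\qquad \mathcal{U}(\sigma,S_\sharp\mu,P)=S_\sharp\,\mathcal{U}(\sigma,\mu,P).$$
   Context: $\mathcal{W}_2(\mathbb{R}^n)$ is the set of Borel probability measures on $\mathbb{R}^n$ with finite second moment, and $\mathcal{W}_{2,ac}(\mathbb{R}^n)$ the subset of those absolutely continuous with respect to Lebesgue measure. $\sharp$ denotes pushforward. For $\theta\in S^{n-1}$, $\sigma^\theta$ is the pushforward of $\sigma$ under $x\mapsto x\cdot\theta$. For one-dimensional measures $\alpha$ (absolutely continuous) and $\beta$, $T_\alpha^\beta=F_\beta^{-1}\circ F_\alpha$ is the optimal transport map ($F_\alpha$ the cumulative distribution function, $F_\beta^{-1}$ the quantile function), i.e. the $\alpha$-a.e. unique nondecreasing map pushing $\alpha$ to $\beta$. For $P=[\theta_1,\ldots,\theta_n]\in O(n)$ (orthogonal matrix with columns $\theta_i$), $T_{\sigma,\mu;P}(x)=\sum_{i=1}^nT_{\sigma^{\theta_i}}^{\mu^{\theta_i}}(x\cdot\theta_i)\,\theta_i$. The slice-matching operator is $\mathcal{U}:\mathcal{W}_{2,ac}(\mathbb{R}^n)\times\mathcal{W}_2(\mathbb{R}^n)\times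 O(n)\to\mathcal{W}_2(\mathbb{R}^n)$, $\mathcal{U}(\sigma,\mu,P)=(T_{\sigma,\mu;P})_\sharp\sigma$. *)

(* Defs.v *)
From HB Require Import structures.
From mathcomp Require Import all_boot all_order all_algebra.
From mathcomp Require Import all_classical all_reals all_analysis.
From mathcomp Require Import measurable_realfun giry.

Set Implicit Arguments.
Unset Strict Implicit.
Unset Printing Implicit Defensive.

Import Order.TTheory GRing.Theory Num.Theory numFieldNormedType.Exports.
Local Open Scope classical_set_scope.
Local Open Scope ring_scope.

Definition borel_mx_display : measure_display. Proof. exact. Qed.

(* The Borel sigma-algebra of R^n, seen as the space of column vectors; the
   topology of matrices is the product (equivalently, the norm) topology. *)
HB.instance Definition _ (R : realType) (m n : nat) :=
  @isMeasurable.Build borel_mx_display 'M[R]_(m, n) <<s @open 'M[R]_(m, n) >>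
    (@sigma_algebra0 _ _ _) (@sigma_algebraC _ _) (@sigma_algebra_bigcup _ _ _).

Lemma measurable_coord_mx (R : realType) (m n : nat) (i : 'I_m) (j : 'I_n) :
  measurable_fun [set: 'M[R]_(m, n)] (fun x : 'M[R]_(m, n) => x i j).
Proof.
apply: (measurability _ (RGenOpens.measurableE R)).
move=> _ [_ [a [b ->] <-]].
rewrite setTI; apply: sub_sigma_algebra.
by apply: open_comp => [x _|]; [exact: coord_continuous|exact: interval_open].
Qed.

(* The two lemmas below show that the Borel sigma-algebra is generated by the
   coordinates: every open set is a countable union of rational boxes. *)
Definition rat_box (R : realType) (m n : nat) (qk : 'M[rat]_(m, n) * nat) :
    set 'M[R]_(m, n) :=
  [set x | forall i j, `|x i j - ratr (qk.1 i j)| < qk.2.+1%:R^-1].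

Lemma open_rat_box (R : realType) (m n : nat) (U : set 'M[R]_(m, n)) : open U ->
  U = \bigcup_(qk in [set qk | @rat_box R m n qk `<=` U]) @rat_box R m n qk.
Proof.
move=> oU; apply/seteqP; split=> [x Ux|x [qk /= qkU qkx]]; last exact: qkU.
have /nbhs_ballP[e /= e0 eU] : nbhs x U by exact: open_nbhs_nbhs.
pose k := Num.truncn (e / 2)^-1.
have ke : k.+1%:R^-1 < e / 2.
  rewrite -[ltRHS]invrK ltf_pV2 ?posrE ?invr_gt0 ?divr_gt0//.
  exact: truncnS_gt.
have /choice[q qP] (ij : 'I_m * 'I_n) : exists q : rat,
    `|x ij.1 ij.2 - ratr q| < k.+1%:R^-1.
  have [|q] := @rat_in_itvoo R
      (x ij.1 ij.2 - k.+1%:R^-1) (x ij.1 ij.2 + k.+1%:R^-1).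
    by rewrite ltrBlDr -addrA ltrDl addr_gt0.
  rewrite in_itv/= => /andP[q1 q2]; exists q.
  by rewrite distrC ltr_distl q1 q2.
exists (\matrix_(i, j) q (i, j), k) => /=; last first.
  by move=> i j/=; rewrite mxE; exact: (qP (i, j)).
move=> y xy; apply: eU; split=> // i j; rewrite /ball/=.
have := xy i j; have := qP (i, j); rewrite /= mxE => h1 h2.
rewrite (splitr e) -(subrKA (ratr (q (i, j)))).
rewrite (le_lt_trans (ler_normD _ _))// ltrD//; first exact: lt_trans h1 ke.
by rewrite distrC; exact: lt_trans h2 ke.
Qed.

Lemma measurable_fun_mx d (T : measurableType d) (R : realType) (m n : nat)
    (f : T -> 'M[R]_(m, n)) :
  (forall i j, measurable_fun [set: T] (fun t => f t i j)) ->
  measurable_fun [set: T] f.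
Proof.
move=> mf; apply: (@measurability _ _ _ _ _ _ (@open 'M[R]_(m, n))) => //.
move=> _ [U oU <-]; rewrite setTI (open_rat_box oU) preimage_bigcup.
rewrite bigcup_mkcond; apply: countable_bigcupT_measurable => // qk.
case: ifPn => // _.
rewrite (_ : _ @^-1` _ = \bigcap_i \bigcap_j
    ((fun t => f t i j) @^-1` ball (ratr (qk.1 i j) : R) qk.2.+1%:R^-1)).
  apply: fin_bigcap_measurable => // i _; apply: fin_bigcap_measurable => // j _.
  rewrite -[X in measurable X]setTI; apply: mf => //.
  by apply: open_measurable; apply: ball_open; rewrite invr_gt0.
apply/seteqP; split=> [t h i _ j _|t h i j].
  by rewrite /ball/= distrC; exact: h.
by have := h i Logic.I j Logic.I; rewrite /ball/= distrC.
Qed.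

HB.instance Definition _ d (T : measurableType d) :=
  isMeasurableFun.Build d d T T idfun (@measurable_id d T setT).

Section euclidean.
Context {R : realType} {n : nat}.

Definition dotv (theta x : 'cV[R]_n) : R := \sum_i x i 0 * theta i 0.

Lemma measurable_dotv (theta : 'cV[R]_n) :
  measurable_fun [set: 'cV[R]_n] (dotv theta).
Proof.
apply: measurable_sum => i; apply: measurable_funM => //.
exact: measurable_coord_mx.
Qed.

HB.instance Definition _ (theta : 'cV[R]_n) :=
  isMeasurableFun.Build _ _ _ _ (dotv theta) (measurable_dotv theta).

Definition affine (a : R) (b x : 'cV[R]_n) : 'cV[R]_n := a *: x + b.

Lemma measurable_affine (a : R) (b : 'cV[R]_n) :
  measurable_fun [set: 'cV[R]_n] (affine a b).
Proof.
apply: measurable_fun_mx => i j.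
apply: (eq_measurable_fun (fun x : 'cV[R]_n => a * x i j + b i j)) => [x _|].
  by rewrite !mxE.
apply: measurable_funD => //; apply: measurable_funM => //.
exact: measurable_coord_mx.
Qed.

HB.instance Definition _ (a : R) (b : 'cV[R]_n) :=
  isMeasurableFun.Build _ _ _ _ (affine a b) (measurable_affine a b).

Definition orthogonalmx (P : 'M[R]_n) : Prop := P^T *m P = 1%:M.

End euclidean.

Section lebesgue.
Context {R : realType}.

(* The identification R x R^n = R^n.+1, along which the product measure
   lebesgue_measure \x m is transported. *)
Definition cons_cV n (p : measurableTypeR R * 'cV[R]_n) : 'cV[R]_n.+1 :=
  col_mx (p.1%:M : 'cV[R]_1) p.2.

Lemma cons_cV0 n p : @cons_cV n p ord0 0 = p.1.
Proof.
have -> : (ord0 : 'I_n.+1) = lshift n (ord0 : 'I_1) by exact/val_inj.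
by rewrite [LHS](@col_mxEu R 1 n 1) mxE.
Qed.

Lemma cons_cVS n p k : @cons_cV n p (lift ord0 k) 0 = p.2 k 0.
Proof.
have -> : lift ord0 k = rshift 1 k by exact/val_inj.
by rewrite [LHS](@col_mxEd R 1 n 1).
Qed.

Lemma measurable_cons_cV n : measurable_fun setT (@cons_cV n).
Proof.
apply: measurable_fun_mx => i j; rewrite ord1.
have [k|] := unliftP ord0 i => ->.
  apply: (eq_measurable_fun
    (fun p : measurableTypeR R * 'cV[R]_n => p.2 k 0)) => [p _|].
    by rewrite cons_cVS.
  exact: (measurableT_comp (measurable_coord_mx k 0) measurable_snd).
apply: (eq_measurable_fun
  (fun p : measurableTypeR R * 'cV[R]_n => p.1)) => [p _|].
  by rewrite cons_cV0.
exact: measurable_fst.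
Qed.

Definition uncons_cV n (x : 'cV[R]_n.+1) : measurableTypeR R * 'cV[R]_n :=
  (x ord0 0, @dsubmx R 1 n 1 x).

Lemma measurable_uncons_cV n : measurable_fun setT (@uncons_cV n).
Proof.
apply/measurable_fun_pairP; split; first exact: measurable_coord_mx.
apply: measurable_fun_mx => i j.
apply: (eq_measurable_fun (fun x : 'cV[R]_n.+1 => x (rshift 1 i) j)) => [x _|].
  by rewrite /= mxE.
exact: measurable_coord_mx.
Qed.

Lemma cons_cVK n : cancel (@cons_cV n) (@uncons_cV n).
Proof.
move=> [x y]; congr (_, _); first exact: cons_cV0.
exact: col_mxKd.
Qed.

HB.instance Definition _ n :=
  isMeasurableFun.Build _ _ _ _ (@cons_cV n) (@measurable_cons_cV n).

Section step.
Context {n : nat} (m : {sigma_finite_measure set 'cV[R]_n -> \bar R}).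

Definition lebesgue_step : set 'cV[R]_n.+1 -> \bar R :=
  pushforward (lebesgue_measure \x m)%E (@cons_cV n).

Let lebesgue_step0 : lebesgue_step set0 = 0%E.
Proof. exact: measure0. Qed.

Let lebesgue_step_ge0 A : (0 <= lebesgue_step A)%E.
Proof. exact: measure_ge0. Qed.

Let lebesgue_step_sigma_additive : semi_sigma_additive lebesgue_step.
Proof. exact: measure_semi_sigma_additive. Qed.

HB.instance Definition _ := isMeasure.Build _ _ _ lebesgue_step
  lebesgue_step0 lebesgue_step_ge0 lebesgue_step_sigma_additive.

Let lebesgue_step_sigma_finite : sigma_finite setT lebesgue_step.
Proof.
have /sigma_finiteP[F [FT ndF Foo]] := sigma_finiteT (@lebesgue_measure R).
have /sigma_finiteP[G [GT ndG Goo]] := sigma_finiteT m.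
exists (fun k => @uncons_cV n @^-1` (F k `*` G k)) => [|k].
  apply/seteqP; split=> // x _.
  have [k _ Fk] : (\bigcup_k F k) (uncons_cV x).1 by rewrite -FT.
  have [l _ Gl] : (\bigcup_k G k) (uncons_cV x).2 by rewrite -GT.
  exists (maxn k l) => //; split.
    by move: Fk; exact/subsetPset/ndF/leq_maxl.
  by move: Gl; exact/subsetPset/ndG/leq_maxr.
have [mF Fk] := Foo k; have [mG Gk] := Goo k; split.
  rewrite -[X in measurable X]setTI.
  by apply: measurable_uncons_cV => //; exact: measurableX.
rewrite /lebesgue_step /pushforward -comp_preimage.
rewrite (_ : _ \o _ = id) ?preimage_id; last by apply/funext/cons_cVK.
by rewrite product_measure1E// lte_mul_pinfty// ge0_fin_numE.
Qed.

HB.instance Definition _ := Measure_isSigmaFinite.Build _ _ _ lebesgue_step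
  lebesgue_step_sigma_finite.
End step.

(* Lebesgue measure on R^n as an iterated product measure; R^0 is a point. *)
Fixpoint lebesgue_cV n : {sigma_finite_measure set 'cV[R]_n -> \bar R} :=
  if n is n'.+1 then lebesgue_step (lebesgue_cV n') else \d_(0 : 'cV[R]_0).

Lemma lebesgue_cV_box n (A : 'I_n -> set R) : (forall i, measurable (A i)) ->
  lebesgue_cV n [set x : 'cV[R]_n | forall i, A i (x i 0)] =
  (\prod_(i < n) lebesgue_measure (A i))%E.
Proof.
elim: n A => [|n IH] A mA /=.
  by rewrite big_ord0 /dirac indicE mem_set//= => -[].
rewrite big_ord_recl -(IH (fun i => A (lift ord0 i)))//.
rewrite /lebesgue_step /pushforward -product_measure1E//; last first.
- rewrite (_ : [set x | _] = \bigcap_i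
      ((fun x : 'cV[R]_n => x i 0) @^-1` A (lift ord0 i))).
    apply: fin_bigcap_measurable => // i _; rewrite -[X in measurable X]setTI.
    exact: measurable_coord_mx.
  by apply/seteqP; split=> [x h i _|x h i]; [exact: h|exact: (h i Logic.I)].
- exact: mA.
congr (_ _); apply/seteqP; split=> [[x y] h|[x y] [/= hx hy] i].
  split=> [|i] /=; first by have := h ord0; rewrite cons_cV0.
  by have := h (lift ord0 i); rewrite cons_cVS.
have [j|] := unliftP ord0 i => ->; first by rewrite cons_cVS.
by rewrite cons_cV0.
Qed.

End lebesgue.

Section transport.
Context {R : realType}.

(* F_beta^-1(p) = inf {t | p <= F_beta(t)}, with values in [-oo, +oo]; it is
   finite for 0 < p < 1. *)
Definition quantile (beta : probability R R) (p : R) : \bar R :=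
  ereal_inf [set t%:E | t in
    [set t : R | (p%:E <= cdf (idfun : {RV beta >-> R}) t)%E]].

(* T_alpha^beta = F_beta^-1 \o F_alpha. When alpha has no atom, F_alpha takes
   its values in ]0, 1[ alpha-almost everywhere, so that the default value 0
   of fine at -oo and +oo is irrelevant. *)
Definition ot_map (alpha beta : probability R R) (t : R) : R :=
  fine (quantile beta (fine (cdf (idfun : {RV alpha >-> R}) t))).

Lemma measurable_ot_map (alpha beta : probability R R) :
  measurable_fun [set: R] (ot_map alpha beta).
Proof.
apply: measurableT_comp; first exact: fine_measurable.
apply: (measurability _ (ErealGenCInfty.measurableE R)) => //.
move=> _ [_ [c ->] <-]; rewrite setTI; apply: is_interval_measurable.
move=> s t /= + _ u /andP[su _]; rewrite !in_itv/= !andbT => /le_trans; apply.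
apply: ereal_inf_le_tmp => _ [v /= uv <-]; exists v => //=.
apply: le_trans uv; rewrite lee_fin fine_le ?fin_num_measure//.
exact: cdf_nondecreasing.
Qed.

End transport.

Section slice_matching.
Context {R : realType} {n : nat}.
Implicit Types sigma mu : probability 'cV[R]_n R.

(* The image measure of sigma under x |-> x . theta; distribution P f is the
   pushforward f_# P as a probability measure. *)
Definition slice sigma (theta : 'cV[R]_n) : probability R R :=
  distribution sigma (dotv theta).

Definition slice_map sigma mu (P : 'M[R]_n) (x : 'cV[R]_n) : 'cV[R]_n :=
  \sum_(i < n) ot_map (slice sigma (col i P)) (slice mu (col i P))
    (dotv (col i P) x) *: col i P.

Lemma measurable_slice_map sigma mu (P : 'M[R]_n) :
  measurable_fun [set: 'cV[R]_n] (slice_map sigma mu P).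
Proof.
apply: measurable_fun_mx => k j.
under eq_fun do rewrite summxE.
apply: measurable_sum => i; under eq_fun do rewrite mxE.
apply: measurable_funM => //.
by apply: measurableT_comp; [exact: measurable_ot_map|exact: measurable_dotv].
Qed.

HB.instance Definition _ sigma mu (P : 'M[R]_n) :=
  isMeasurableFun.Build _ _ _ _ (slice_map sigma mu P)
    (measurable_slice_map sigma mu P).

(* U(sigma, mu, P), defined for all probability measures sigma and mu. *)
Definition slice_matching sigma mu (P : 'M[R]_n) : probability 'cV[R]_n R :=
  distribution sigma (slice_map sigma mu P).

Definition W2 mu : Prop := (\int[mu]_x (dotv x x)%:E < +oo)%E.

Definition W2ac sigma : Prop := W2 sigma /\ sigma `<< lebesgue_cV n.

End slice_matching.

(* Main.v *)
(* Slicing turns x |-> a x + b into t |-> a t + b.theta, so the cdf of a slice is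
   precomposed, and its quantile function postcomposed, with an increasing affine
   map. For the source measure this makes the two slice-matching maps agree
   pointwise along S. For the target measure, summing over an orthonormal basis
   reconstructs b, but the quantile identity may fail (through the junk value of
   fine) where the cdf of the source slice is 0 or 1. As sigma is absolutely
   continuous, hyperplanes are null, the slices have no atoms, and the level sets
   of their cdfs are null; hence the exceptional set is negligible. *)
Require Import Defs.
From mathcomp Require Import all_boot all_order all_algebra.
From mathcomp Require Import all_classical all_reals all_analysis.
From mathcomp Require Import measurable_realfun giry.
From mathcomp Require Import ring lra.

Set Implicit Arguments.
Unset Strict Implicit.
Unset Printing Implicit Defensive.

Import Order.TTheory GRing.Theory Num.Theory numFieldNormedType.Exports.
Local Open Scope classical_set_scope.
Local Open Scope ring_scope.

(** * Negligible unions, and quantiles under increasing affine maps *)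

Lemma negligible_bigcup_count d (T : measurableType d) (R : realType)
    (mu : {measure set T -> \bar R}) (I : countType) (D : set I)
    (F : I -> set T) :
  (forall i, D i -> mu.-negligible (F i)) ->
  mu.-negligible (\bigcup_(i in D) F i).
Proof.
move=> F0; pose G i := if i \in D then F i else set0.
apply: (@negligibleS _ _ _ _ (\bigcup_k oapp G set0 (unpickle k))).
  move=> t [i Di Fit]; exists (pickle i) => //.
  by rewrite pickleK /= /G mem_set.
apply: negligible_bigcup => k; case: unpickle => [i|] /=.
  by rewrite /G; case: ifPn => [/set_mem/F0//|_]; exact: negligible_set0.
exact: negligible_set0.
Qed.

(** The cdf tends to 1 at [+oo] and to 0 at [-oo]: a point where it exceeds [p] bounds the infimum
    from above, and a point where it is below [p] bounds it from below. *)
Lemma quantile_fin_num (R : realType) (beta : probability R R) (p : R) :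
  0 < p < 1 -> quantile beta p \is a fin_num.
Proof.
move=> /andP[p0 p1]; set F := cdf (idfun : {RV beta >-> R}).
have [t pt] : exists t, (p%:E < F t)%E.
  have [//|M [_ MF]] := @cvg_cdfy1 _ _ _ _ (idfun : {RV beta >-> R})
    [set x | p%:E < x]%E.
    exact: open_ereal_gt'.
  by exists (M + 1); apply: MF; rewrite ltrDl.
have [s ps] : exists s, (F s < p%:E)%E.
  have [//|M [_ MF]] := @cvg_cdfNy0 _ _ _ _ (idfun : {RV beta >-> R})
    [set x | x < p%:E]%E.
    exact: open_ereal_lt'.
  by exists (M - 1); apply: MF; rewrite gtrBl.
rewrite fin_numElt; apply/andP; split.
  apply: (@lt_le_trans _ _ s%:E); first exact: ltNyr.
  apply/ereal_infP => _ [u /= pu <-]; rewrite lee_fin leNgt; apply/negP => us.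
  have := le_lt_trans pu (le_lt_trans (cdf_nondecreasing _ (ltW us)) ps).
  by rewrite ltxx.
apply: (@le_lt_trans _ _ t%:E); last exact: ltry.
by apply: ereal_inf_lbound; exists t => //=; exact: ltW.
Qed.

(** The substitution [(t - c) / a] sends the set whose infimum is [quantile beta p] into the one for
    [quantile alpha p]. *)
Lemma quantile_affine_ge (R : realType) (alpha beta : probability R R)
    (a c p : R) :
  0 < a -> 0 < p < 1 ->
  (forall t, cdf (idfun : {RV beta >-> R}) (a * t + c)
           = cdf (idfun : {RV alpha >-> R}) t) ->
  a * fine (quantile alpha p) + c <= fine (quantile beta p).
Proof.
move=> a0 p01 ab; rewrite -lee_fin (fineK (quantile_fin_num _ _))//.
apply/ereal_infP => _ [t /= pt <-].
rewrite lee_fin -lerBrDr mulrC -ler_pdivlMr//.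
rewrite -lee_fin (fineK (quantile_fin_num _ _))//.
apply: ereal_inf_lbound; exists ((t - c) / a) => //=.
by rewrite -ab mulrC divfK ?gt_eqF// subrK.
Qed.

Lemma quantile_affine (R : realType) (alpha beta : probability R R)
    (a c p : R) :
  0 < a -> 0 < p < 1 ->
  (forall t, cdf (idfun : {RV beta >-> R}) (a * t + c)
           = cdf (idfun : {RV alpha >-> R}) t) ->
  fine (quantile beta p) = a * fine (quantile alpha p) + c.
Proof.
move=> a0 p01 ab; apply/eqP; rewrite eq_le quantile_affine_ge// andbT.
rewrite -lerBlDr mulrC -ler_pdivrMr//.
(* The reverse inequality is the same lemma with [alpha] and [beta] exchanged, for the inverse map
   with slope [a^-1] and intercept [- (c / a)]. *)
rewrite mulrBl mulrC; apply: quantile_affine_ge; rewrite ?invr_gt0// => t.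
rewrite -ab; congr cdf; field; exact: lt0r_neq0.
Qed.

(** * Level sets of a cdf *)

Lemma itvoc_negligible (R : realType) (alpha : probability R R) (q r : R) :
  cdf (idfun : {RV alpha >-> R}) q = cdf (idfun : {RV alpha >-> R}) r ->
  alpha.-negligible `]q, r].
Proof.
have [rq _|qr] := leP r q.
  by rewrite set_itv_ge -?leNgt ?bnd_simp//; exact: negligible_set0.
rewrite /cdf /distribution /pushforward/= !preimage_id => qr'.
apply/negligibleP => //.
(* Splitting at [q] makes the mass of []q, r]] the difference of the two cdf values, which is 0. *)
have : (alpha `]-oo, r]%classic =
    alpha `]q, r]%classic + alpha `]-oo, q]%classic)%E.
  rewrite addeC -measureU//.
    by rewrite -itv_bndbnd_setU// bnd_simp// ltW.
  by rewrite -subset0 => x /=; rewrite !in_itv/= => -[xq /andP[]];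
    rewrite ltNge xq.
move/(congr1 (fun x => x - alpha `]-oo, q]%classic)%E).
rewrite addeK ?fin_num_measure// => /esym E; apply: (eq_trans E).
by rewrite qr' subee// fin_num_measure.
Qed.

(* The level set is order-convex, so apart from its possible minimum and maximum
   it is covered by the half-open intervals with rational endpoints in it, on
   which the cdf does not increase. *)
Lemma cdf_fiber_negligible (R : realType) (alpha : probability R R)
    (c : \bar R) :
  (forall t, alpha [set t] = 0%E) ->
  alpha.-negligible (cdf (idfun : {RV alpha >-> R}) @^-1` [set c]).
Proof.
move=> alpha1; set F := cdf _; set A := F @^-1` _.
have negl1 (E : set R) :
    (forall s t, E s -> E t -> s = t) -> alpha.-negligible E.
  move=> E1; have [->|/set0P[t Et]] := eqVneq E set0.
    exact: negligible_set0.
  apply: (@negligibleS _ _ _ _ [set t]) => [s Es|]; first exact: E1.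
  by apply/negligibleP => //; exact: alpha1.
pose I := ([set t | A t /\ forall s, A s -> t <= s] `|`
  [set t | A t /\ forall s, A s -> s <= t]) `|`
  \bigcup_(qr in [set qr : rat * rat | A (ratr qr.1) /\ A (ratr qr.2)])
    `]ratr qr.1, ratr qr.2]%classic.
apply: (@negligibleS _ _ _ _ I) => [t At|].
  have [?|/existsNP[s /not_implyP[As /negP]]] :=
    pselect (forall s, A s -> t <= s).
    by left; left.
  rewrite -ltNge => st.
  have [?|/existsNP[u /not_implyP[Au /negP]]] :=
    pselect (forall s, A s -> s <= t).
    by left; right.
  rewrite -ltNge => tu; right.
  have [q] := rat_in_itvoo st; rewrite in_itv/= => /andP[sq qt].
  have [r] := rat_in_itvoo tu; rewrite in_itv/= => /andP[tr ru].
  have AP v : s <= v <= u -> A v.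
    move=> /andP[sv vu]; apply/le_anti/andP; split.
      by rewrite -[leRHS](Au : F u = c); exact: cdf_nondecreasing.
    by rewrite -[leLHS](As : F s = c); exact: cdf_nondecreasing.
  exists (q, r) => /=; last by rewrite in_itv/= qt ltW.
  by split; apply: AP; apply/andP; split; lra.
apply: negligibleU; first apply: negligibleU.
- apply: negl1 => s t [As sA] [At tA]; apply/eqP.
  by rewrite eq_le sA// tA.
- apply: negl1 => s t [As sA] [At tA]; apply/eqP.
  by rewrite eq_le sA// tA.
apply: negligible_bigcup_count => -[q r] [Aq Ar].
by apply: itvoc_negligible; rewrite -/F; exact: (etrans Aq (esym Ar)).
Qed.

(** * Null hyperplanes and atomless slices *)

Lemma measurable_hyperplane (R : realType) (n : nat) (theta : 'cV[R]_n)
    (c : R) :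
  measurable [set x | dotv theta x = c].
Proof. exact: (measurable_funPTI (dotv theta) (measurable_set1 c)). Qed.

(** Induction on the dimension, splitting off the first coordinate. If the remaining coordinates
    [tail] of the normal vector are not all 0, every section is a hyperplane one dimension lower;
    otherwise the hyperplane is a point times a full space. *)
Lemma lebesgue_cV_hyperplane (R : realType) (n : nat) (theta : 'cV[R]_n)
    (c : R) :
  theta != 0 -> lebesgue_cV n [set x | dotv theta x = c] = 0%E.
Proof.
elim: n theta c => [|n IH] theta c theta0.
  by rewrite flatmx0 eqxx in theta0.
pose tail : 'cV[R]_n := \col_i theta (lift ord0 i) 0.
have dotE (p : measurableTypeR R * 'cV[R]_n) :
    dotv theta (cons_cV p) = p.1 * theta ord0 0 + dotv tail p.2.
  rewrite /dotv big_ord_recl cons_cV0; congr (_ + _).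
  by apply: eq_bigr => i _; rewrite cons_cVS mxE.
rewrite /= /lebesgue_step /pushforward.
have [tail0|tail0] := eqVneq tail 0; last first.
  apply: integral0_eq => x _ /=.
  rewrite -[RHS](IH tail (c - x * theta ord0 0) tail0).
  congr (lebesgue_cV n _); apply/seteqP; split => y;
    rewrite /xsection/= ?inE/= dotE/=.
    by move=> <-; rewrite addrC addKr.
  by move=> ->; rewrite addrC subrK.
have theta00 : theta ord0 0 != 0.
  apply: contraNneq theta0 => h; apply/eqP/matrixP => i j; rewrite ord1 mxE.
  have [k|] := unliftP ord0 i => -> //.
  by move/matrixP : tail0 => /(_ k 0); rewrite !mxE.
have -> : @cons_cV R n @^-1` [set x | dotv theta x = c] =
    [set c / theta ord0 0] `*` [set: 'cV[R]_n].
  have dot0 y : dotv tail y = 0.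
    by rewrite tail0; apply: big1 => i _; rewrite mxE mulr0.
  apply/seteqP; split => [[x y]|[x y]]/=; rewrite dotE/= dot0 addr0.
    by move=> <-; rewrite mulfK.
  by move=> [-> _]; rewrite divfK.
(* The second factor may have infinite measure; [0 * +oo = 0] in the extended reals. *)
by rewrite product_measure1E//= lebesgue_measure_set1 mul0e.
Qed.

Lemma slice_atomless (R : realType) (n : nat) (sigma : probability 'cV[R]_n R)
    (theta : 'cV[R]_n) (c : R) :
  sigma `<< lebesgue_cV n -> theta != 0 -> slice sigma theta [set c] = 0%E.
Proof.
move=> /null_content_dominatesP sl theta0.
apply: sl; first exact: measurable_hyperplane.
exact: lebesgue_cV_hyperplane.
Qed.

Lemma ae_cdf_slice (R : realType) (n : nat) (sigma : probability 'cV[R]_n R)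
    (theta : 'cV[R]_n) :
  sigma `<< lebesgue_cV n -> theta != 0 ->
  {ae sigma, forall x,
    0 < fine (cdf (idfun : {RV (slice sigma theta) >-> R}) (dotv theta x)) < 1}.
Proof.
move=> sl theta0; set F := cdf _.
have F01 : (slice sigma theta).-negligible
    (F @^-1` [set 0%E] `|` F @^-1` [set 1%E]).
  by apply: negligibleU; apply: cdf_fiber_negligible => t;
    exact: slice_atomless.
have [B [mB B0 FB]] := F01.
(* The slice is the image of [sigma] under [dotv theta], so the slice mass of [B] is the
   [sigma]-mass of this preimage. *)
exists (dotv theta @^-1` B); split => //.
  exact: (measurable_funPTI (dotv theta)).
move=> x /= Fx; apply: FB => /=.
apply: contrapT => /not_orP[Fx0 Fx1]; apply: Fx.
have Ffin : F (dotv theta x) \is a fin_num by rewrite fin_num_measure.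
rewrite -!lte_fin fineK// !lt_neqAle cdf_ge0 cdf_le1 !andbT.
by apply/andP; split; apply/eqP => // /esym.
Qed.

(** * Slices and slice-matching maps under affine maps *)

Section affine_slices.
Context {R : realType} {n : nat}.
Implicit Types sigma mu : probability 'cV[R]_n R.

Lemma dotv_affine (theta b x : 'cV[R]_n) (a : R) :
  dotv theta (affine a b x) = a * dotv theta x + dotv theta b.
Proof.
rewrite /dotv mulr_sumr -big_split; apply: eq_bigr => i _ /=.
by rewrite !mxE mulrDl mulrA.
Qed.

Lemma cdf_slice_affine sigma (theta b : 'cV[R]_n) (a t : R) : 0 < a ->
  cdf (idfun : {RV (slice (distribution sigma (affine a b)) theta) >-> R})
    (a * t + dotv theta b) =
  cdf (idfun : {RV (slice sigma theta) >-> R}) t.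
Proof.
move=> a0; congr (sigma _); apply/seteqP; split => x /=;
  by rewrite !in_itv/= dotv_affine lerD2r ler_pM2l.
Qed.

Lemma orthogonalmx_col_neq0 (P : 'M[R]_n) i : orthogonalmx P -> col i P != 0.
Proof.
move=> /matrixP/(_ i i) PP; apply/eqP => /matrixP Pi0; move: PP.
rewrite !mxE eqxx big1 => [/esym/eqP|k _]; first by rewrite oner_eq0.
by have := Pi0 k 0; rewrite !mxE => ->; rewrite mul0r.
Qed.

(** The sum is [P *m P^T *m b], and a left inverse of a square matrix is also a right inverse. *)
Lemma sum_dotv_col (P : 'M[R]_n) (b : 'cV[R]_n) : orthogonalmx P ->
  \sum_(i < n) dotv (col i P) b *: col i P = b.
Proof.
move=> /mulmx1C PP; rewrite -[RHS]mul1mx -PP -mulmxA.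
apply/colP => k; rewrite summxE [RHS]mxE; apply: eq_bigr => i _.
rewrite !mxE mulrC; congr (_ * _); apply: eq_bigr => j _.
by rewrite !mxE mulrC.
Qed.

Lemma slice_map_affine_source sigma mu (P : 'M[R]_n) (a : R) (b x : 'cV[R]_n) :
  0 < a ->
  slice_map (distribution sigma (affine a b)) mu P (affine a b x) =
  slice_map sigma mu P x.
Proof.
move=> a0; apply: eq_bigr => i _; congr (_ *: _).
by rewrite /ot_map dotv_affine cdf_slice_affine.
Qed.

Lemma slice_map_affine_target sigma mu (P : 'M[R]_n) (a : R) (b : 'cV[R]_n) :
  sigma `<< lebesgue_cV n -> orthogonalmx P -> 0 < a ->
  {ae sigma, forall x, slice_map sigma (distribution mu (affine a b)) P x =
    affine a b (slice_map sigma mu P x)}.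
Proof.
move=> sl PP a0.
have : {ae sigma, forall x, forall i, 0 < fine (cdf
    (idfun : {RV (slice sigma (col i P)) >-> R}) (dotv (col i P) x)) < 1}.
  apply: filter_forall => i; apply: ae_cdf_slice => //.
  exact: orthogonalmx_col_neq0.
(* Expanding [b] along the columns of [P] reduces the claim to one quantile identity per column,
   valid since [F01] puts each cdf value strictly between 0 and 1. *)
apply: filterS => x F01; rewrite /affine -[in RHS](sum_dotv_col b PP).
rewrite scaler_sumr -big_split; apply: eq_bigr => i _ /=.
rewrite scalerA -scalerDl; congr (_ *: _).
by apply: quantile_affine => // t; exact: cdf_slice_affine.
Qed.

End affine_slices.

(** The preimages of [A] under [X] and [Y] differ only inside a null set [N]; adjoining [N] to both
    makes them equal without changing their masses. *)
Lemma ae_eq_distribution d d' (T : measurableType d) (T' : measurableType d')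
    (R : realType) (P : probability T R) (X Y : {mfun T >-> T'}) :
  {ae P, forall x, X x = Y x} -> distribution P X ≡μ distribution P Y.
Proof.
move=> [N [mN N0 XYN]] A mA; rewrite /= /distribution /pushforward.
have mpre (Z : {mfun T >-> T'}) : measurable (Z @^-1` A).
  exact: measurable_funPTI.
have XY x : ~ N x -> X x = Y x.
  by move=> Nx; apply: contrapT => /XYN.
rewrite -(measureU0 (mpre X) mN N0) -(measureU0 (mpre Y) mN N0).
congr (P _); apply/seteqP; split => x /= [Ax|]; try by right.
  by have [|Nx] := pselect (N x); [right|left; rewrite -XY].
by have [|Nx] := pselect (N x); [right|left; rewrite XY].
Qed.

Theorem proposition4p2 (R : realType) (n : nat)
    (sigma mu : probability 'cV[R]_n R)
    (sigma_W2ac : W2ac sigma) (mu_W2 : W2 mu)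
    (P : 'M[R]_n) (P_orth : orthogonalmx P)
    (a : R) (a_gt0 : 0 < a) (b : 'cV[R]_n) :
  slice_matching (distribution sigma (affine a b)) mu P
    ≡μ slice_matching sigma mu P /\
  slice_matching sigma (distribution mu (affine a b)) P
    ≡μ distribution (slice_matching sigma mu P) (affine a b).
Proof.
have [_ sigma_ac] := sigma_W2ac; split.
  move=> A mA; congr (sigma _); apply/seteqP; split => x /=;
    by rewrite slice_map_affine_source.
exact: (ae_eq_distribution (Y := affine a b \o slice_map sigma mu P)
  (slice_map_affine_target mu b sigma_ac P_orth a_gt0)).
Qed.
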